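(* Let $f:(0,\infty)\to\mathbb{R}$ be a convex function with $f(1)=0$ such that, for all probability densities $p,q$ on $\mathbb{R}$ (with respect to Lebesgue measure) that are strictly positive on $\mathbb{R}$, $\mathrm{D}_f(p\|q)=0$ if and only if $p=q$ almost everywhere. Let $X$ and $Y$ be real-valued random variables (not required to be absolutely continuous) with Borel probability laws $\mathbb{P}_X$ and $\mathbb{P}_Y$. Let $K$ be an absolutely continuous real-valued random variable, independent of $X$ and of $Y$, whose density $p_K$ satisfies $p_K(x)>0$ for all $x\in\mathbb{R}$. Let $\phi_K(w)=\mathbb{E}[e^{iwK}]$, $w\in\mathbb{R}$, be the characteristic function of $K$, and suppose that either $\phi_K(w)\neq 0$ for all $w\in\mathbb{R}$, or the set $\{w\in\mathbb{R}:\phi_K(w)=0\}$ is at most countable. Let $\tilde{X}=X+K$ and $\tilde{Y}=Y+K$, which are absolutely continuous with densities $p_{\tilde X}(t)=\int p_K(t-x)\,d\mathbb{P}_X(x)$ and $p_{\tilde Y}(t)=\int p_K(t-y)\,d\mathbb{P}_Y(y)$, and define the stationary spread $f$-divergence $$\tilde{\mathrm{D}}_f(\mathbb{P}_X\|\mathbb{P}_Y):=\mathrm{D}_f(p_{\tilde X}\|p_{\tilde Y})=\int_{\mathbb{R}} f\!\left(\frac{p_{\tilde X}(t)}{p_{\tilde Y}(t)}\right)p_{\tilde Y}(t)\,dt.$$ Then $$\tilde{\mathrm{D}}_f(\mathbb{P}_X\|\mathbb{P}_Y)\geq 0,\qquad\text{and}\qquad \tilde{\mathrm{D}}_f(\mathbb{P}_X\|\mathbb{P}_Y)=0\iff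 \mathbb{P}_X=\mathbb{P}_Y.$$
   Context: For probability densities $p,q$ on $\mathbb{R}$ that are strictly positive, and a convex function $f:(0,\infty)\to\mathbb{R}$ with $f(1)=0$, the $f$-divergence is $$\mathrm{D}_f(p\|q)=\int_{\mathbb{R}} f\!\left(\frac{p(x)}{q(x)}\right)q(x)\,dx,$$ which takes values in $(-\infty,+\infty]$. A real random variable is called absolutely continuous if its law has a density with respect to Lebesgue measure. *)

(* Defs.v *)
From HB Require Import structures.
From mathcomp Require Import all_boot all_order all_algebra.
From mathcomp Require Import all_classical all_reals all_analysis.
From mathcomp Require Import complex.

Set Implicit Arguments.
Unset Strict Implicit.
Unset Printing Implicit Defensive.

Import Order.TTheory GRing.Theory Num.Theory.
Import numFieldNormedType.Exports.

Local Open Scope classical_set_scope.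
Local Open Scope ring_scope.

(* Densities are Borel functions, normalized for the Lebesgue measure. *)
Definition prob_density (R : realType) (p : R -> R) : Prop :=
  [/\ measurable_fun [set: R] p,
      forall x, 0 <= p x &
      (\int[@lebesgue_measure R]_x (p x)%:E = 1)%E].

(* The extended-real integral is (integral of the positive part) - (integral
   of the negative part), with the convention +oo - +oo = -oo. For f convex
   on ]0, +oo[ and p, q densities the negative part is integrable, because f
   has an affine minorant, so that this convention is never used. Values of f
   outside ]0, +oo[ are irrelevant when p and q are positive almost
   everywhere. *)
Definition f_divergence (R : realType) (f p q : R -> R) : \bar R :=
  (\int[@lebesgue_measure R]_x (f (p x / q x) * q x)%:E)%E.

Definition has_density d (T : measurableType d) (R : realType)
    (P : probability T R) (X : {RV P >-> R}) (p : R -> R) : Prop :=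
  prob_density p /\
  forall A : set R, measurable A ->
    (distribution P X A = \int[@lebesgue_measure R]_(x in A) (p x)%:E)%E.

Definition independent_RV d (T : measurableType d) (R : realType)
    (P : probability T R) (X Y : {RV P >-> R}) : Prop :=
  forall A B : set R, measurable A -> measurable B ->
    (P (X @^-1` A `&` Y @^-1` B) = P (X @^-1` A) * P (Y @^-1` B))%E.

Section RV_add.
Context d (T : measurableType d) (R : realType) (P : probability T R).
Variables X Y : {RV P >-> R}.

Let measurable_RV_add : measurable_fun [set: T] (X \+ Y : T -> R).
Proof. exact: measurable_realfun.measurable_funD. Qed.

HB.instance Definition _ :=
  isMeasurableFun.Build _ _ T R (X \+ Y : T -> R) measurable_RV_add.

Definition RV_add : {RV P >-> R} := (X \+ Y : T -> R).

End RV_add.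

Definition expi (R : realType) (t : R) : R[i] := Complex (cos t) (sin t).

Definition cexpectation d (T : measurableType d) (R : realType)
    (P : probability T R) (Z : T -> R[i]) : R[i] :=
  Complex (fine 'E_P[fun s => complex.Re (Z s)]) (fine 'E_P[fun s => complex.Im (Z s)]).

Definition char_fun d (T : measurableType d) (R : realType)
    (P : probability T R) (K : {RV P >-> R}) (w : R) : R[i] :=
  cexpectation P (fun s => expi (w * K s)).

(* Real-valued integral: it takes the value 0 at the points t where the
   integral of the nonnegative function x |-> pK (t - x) is infinite. These
   points form a Lebesgue-null set, since pK is integrable. *)
Definition spread_density (R : realType) (pK : R -> R)
    (mu : probability R R) (t : R) : R :=
  \int[mu]_x pK (t - x).

Definition spread_divergence (R : realType) (f pK : R -> R)
    (mu nu : probability R R) : \bar R :=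
  f_divergence f (spread_density pK mu) (spread_density pK nu).

(* Main.v *)
Require Import Defs.
From HB Require Import structures.
From mathcomp Require Import all_boot all_order all_algebra.
From mathcomp Require Import all_classical all_reals all_analysis.
From mathcomp Require Import measurable_realfun complex.
From mathcomp Require Import ring lra.

Set Implicit Arguments.
Unset Strict Implicit.
Unset Printing Implicit Defensive.

Import Order.TTheory GRing.Theory Num.Theory.
Import numFieldNormedType.Exports.

Local Open Scope classical_set_scope.
Local Open Scope ring_scope.

(* By Tonelli's theorem and the translation invariance of the Lebesgue measure,
   X + K and Y + K have the spread densities p and q, which are positive almost
   everywhere. A convex f with f 1 = 0 has a tangent f u >= c (u - 1), and
   integrating f (p / q) q >= c (p - q) gives the nonnegativity.

   If the divergence vanishes, the hypothesis on f (applied after changing p and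
   q on a null set to make them positive everywhere) gives p = q almost
   everywhere, so X + K and Y + K have the same law. By independence
   phi_X phi_K = phi_Y phi_K, hence phi_X = phi_Y off a countable set, and
   everywhere by continuity.

   The injectivity of the characteristic function is obtained without Fourier
   inversion. The bounded functions that can be multiplied into every test
   function without breaking the equality of all trigonometric integrals form an
   algebra, closed under bounded pointwise limits, which contains
   x |-> sin (u (x - c)). It therefore contains the polynomials in such a sine,
   their limit sign (sin (u (x - c))), then, letting u tend to 0, sign (x - c),
   and finally the indicator of ]c, +oo[. *)

(** * Bounded measurable functions *)

(** Every probability measure integrates these functions, so the real-valued integral is linear on
    them without further conditions. *)
Definition bounded_measurable d (T : measurableType d) (R : realType)
    (g : T -> R) : Prop :=
  measurable_fun setT g /\ exists M, forall x, `|g x| <= M.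

Section bounded_measurable.
Context d (T : measurableType d) (R : realType).
Implicit Types (g h : T -> R) (mu : probability T R).

Lemma bounded_measurable_cst c : bounded_measurable (cst c : T -> R).
Proof. by split; [exact: measurable_cst|exists `|c|]. Qed.

Lemma bounded_measurableD g h :
  bounded_measurable g -> bounded_measurable h -> bounded_measurable (g \+ h).
Proof.
move=> [mg [M gM]] [mh [N hN]]; split; first exact: measurable_funD.
by exists (M + N) => x; rewrite (le_trans (ler_normD _ _))// lerD.
Qed.

Lemma bounded_measurableM g h :
  bounded_measurable g -> bounded_measurable h -> bounded_measurable (g \* h).
Proof.
move=> [mg [M gM]] [mh [N hN]]; split; first exact: measurable_funM.
by exists (M * N) => x; rewrite /= normrM ler_pM.
Qed.

Lemma bounded_measurable_lim (M : R) (g_ : (T -> R)^nat) g :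
  (forall n, bounded_measurable (g_ n)) -> (forall n x, `|g_ n x| <= M) ->
  (forall x, g_ n x @[n --> \oo] --> g x) -> bounded_measurable g.
Proof.
move=> bg gM cg; split.
  by apply: (@measurable_fun_cvg _ _ _ setT g_ g) => [n|x _];
    [have [] := bg n|exact: cg].
exists M => x; apply: (cvgr_to_le (cvg_norm (cg x))).
by apply: nearW => n; exact: gM.
Qed.

Lemma bounded_measurable_integrable mu g :
  bounded_measurable g -> mu.-integrable setT (EFin \o g).
Proof.
move=> [mg [M gM]]; apply: measurable_bounded_integrable => //.
- by rewrite (le_lt_trans (probability_le1 _ _))// ltry.
- by exists M; split => [|r Mr x _ /=]; rewrite ?num_real// (le_trans (gM x))// ltW.
Qed.

Lemma bounded_measurable_RintegralD mu g h :
  bounded_measurable g -> bounded_measurable h ->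
  \int[mu]_x (g x + h x) = \int[mu]_x g x + \int[mu]_x h x.
Proof.
by move=> bg bh; rewrite -RintegralD//; exact: bounded_measurable_integrable.
Qed.

Lemma bounded_measurable_RintegralZ mu c g :
  bounded_measurable g -> \int[mu]_x (c * g x) = c * \int[mu]_x g x.
Proof.
by move=> bg; rewrite RintegralZl//; exact: bounded_measurable_integrable.
Qed.

Lemma bounded_convergence mu (M : R) (g_ : (T -> R)^nat) g :
  (forall n, bounded_measurable (g_ n)) -> (forall n x, `|g_ n x| <= M) ->
  (forall x, g_ n x @[n --> \oo] --> g x) ->
  \int[mu]_x g_ n x @[n --> \oo] --> \int[mu]_x g x.
Proof.
move=> bg gM cg; have bg' := bounded_measurable_lim bg gM cg.
have intg := bounded_measurable_integrable mu bg'.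
have := @dominated_convergence _ _ _ mu setT measurableT
  (fun n x => (g_ n x)%:E) (EFin \o g) (cst M%:E).
case.
- by move=> n; apply/measurable_EFinP; have [] := bg n.
- by apply/measurable_EFinP; have [] := bg'.
- by apply: aeW => x _ /=; apply: cvg_EFin; [exact: nearW|exact: cg].
- exact: finite_measure_integrable_cst.
- by apply: aeW => x n _ /=; rewrite lee_fin.
move=> _ _; rewrite -[X in _ --> X]fineK; last exact: integrable_fin_num.
exact: fine_cvg.
Qed.

End bounded_measurable.
Arguments bounded_measurable_cst {d T R} c.

(** * Injectivity of the characteristic function *)

Section sign_iteration.
Variable R : realType.
Implicit Types (s : R) (n : nat).

(* Maps [-1, 1] to itself with fixed points -1, 0 and 1, of which only 0 is
   repelling: its iterates are polynomials that converge boundedly to the sign. *)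
Definition sign_step s : R := (3 * s - s ^+ 3) / 2.

Lemma sign_stepN s : sign_step (- s) = - sign_step s.
Proof. by rewrite /sign_step; field. Qed.

Lemma iter_sign_stepN n s : iter n sign_step (- s) = - iter n sign_step s.
Proof. by elim: n => //= n ->; rewrite sign_stepN. Qed.

Lemma sign_step_itv s : 0 <= s <= 1 -> s <= sign_step s <= 1.
Proof.
move=> /andP[s0 s1]; rewrite -subr_ge0 -[_ <= 1]subr_ge0.
have -> : sign_step s - s = s * (1 - s) * (1 + s) / 2.
  by rewrite /sign_step; field.
have -> : 1 - sign_step s = (1 - s) ^+ 2 * (2 + s) / 2.
  by rewrite /sign_step; field.
by rewrite !divr_ge0 ?mulr_ge0 ?sqr_ge0//; lra.
Qed.

Lemma iter_sign_step_itv n s : 0 <= s <= 1 -> s <= iter n sign_step s <= 1.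
Proof.
move=> s01; elim: n => [|n /andP[sn n1]] /=.
  by case/andP: s01 => _ ->; rewrite lexx.
have /sign_step_itv/andP[ln l1] : 0 <= iter n sign_step s <= 1.
  by rewrite n1 andbT (le_trans _ sn)//; case/andP: s01.
by rewrite l1 (le_trans sn).
Qed.

Lemma norm_iter_sign_step n s : `|s| <= 1 -> `|iter n sign_step s| <= 1.
Proof.
wlog s0 : s / 0 <= s => [H|].
  have [/H//|s0 s1] := leP 0 s.
  by rewrite -normrN -iter_sign_stepN H ?normrN// oppr_ge0 ltW.
rewrite ger0_norm// => s1.
have /andP[sn n1] := @iter_sign_step_itv n s ltac:(by rewrite s0 s1).
by rewrite ger0_norm// (le_trans s0).
Qed.

(** The identity [1 - sign_step t = (1 - t) * (1 - (t + t ^+ 2) / 2)] contracts the distance to 1;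
    as the iterates stay above [s], the factor is at most [1 - s / 2]. *)
Lemma iter_sign_step_geometric n s : 0 <= s <= 1 ->
  1 - (1 - s / 2) ^+ n <= iter n sign_step s.
Proof.
move=> s01; elim: n => [|n ih] /=; first by rewrite expr0 subrr; case/andP: s01.
have /andP[sn n1] := iter_sign_step_itv n s01.
case/andP: s01 => s0 s1; move: ih sn n1; rewrite exprS.
set t := iter n _ s; set e := _ ^+ n => ih sn n1.
have e0 : 0 <= e by rewrite exprn_ge0//; lra.
have -> : sign_step t = 1 - (1 - t) * (1 - (t + t ^+ 2) / 2).
  by rewrite /sign_step; field.
rewrite lerB// [leRHS]mulrC; apply: ler_pM; [lra|nra|lra|nra].
Qed.

(** The geometric bound and the upper bound 1 squeeze the iterates of a positive [s]; oddness gives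
    the negative case, and 0 is fixed. *)
Lemma cvg_iter_sign_step s : `|s| <= 1 -> iter n sign_step s @[n --> \oo] --> Num.sg s.
Proof.
have pos r : 0 < r -> r <= 1 -> iter n sign_step r @[n --> \oo] --> (1 : R).
  move=> r0 r1; have r01 : 0 <= r <= 1 by rewrite ltW.
  apply: (@squeeze_cvgr _ _ _ _ (fun n => 1 - (1 - r / 2) ^+ n) (cst 1)).
  - apply: nearW => n; rewrite iter_sign_step_geometric//=.
    by have /andP[] := iter_sign_step_itv n r01.
  - rewrite -[X in _ --> X]subr0; apply: cvgB; first exact: cvg_cst.
    by apply: cvg_expr; rewrite ger0_norm; lra.
  - exact: cvg_cst.
move=> s1; case: (ltgtP s 0) => s0.
- rewrite ltr0_sg//.
  have := pos (- s) ltac:(by rewrite oppr_gt0) ltac:(by rewrite -ltr0_norm).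
  under eq_cvg do rewrite iter_sign_stepN.
  by move=> /cvgN; under eq_cvg do rewrite opprK.
- by rewrite gtr0_sg//; apply: pos => //; rewrite -(gtr0_norm s0).
- rewrite s0 sgr0; have H n : iter n sign_step (0 : R) = 0.
    by elim: n => //= n ->; rewrite /sign_step; field.
  by under eq_cvg do rewrite H; exact: cvg_cst.
Qed.

(** The sequence is eventually constant: once [n.+1] exceeds the absolute value of [y], the angle is
    so small that its sine has its sign. *)
Lemma cvg_sg_sin (y : R) :
  Num.sg (sin (n.+1%:R^-1 * y)) @[n --> \oo] --> Num.sg y.
Proof.
apply: cvg_near_cst; near=> n.
have ny : `|y| < n.+1%:R.
  by rewrite (lt_le_trans (truncnS_gt _))// ler_nat; near: n; exact: nbhs_infty_ge.
have n0 : 0 < n.+1%:R^-1 :> R by rewrite invr_gt0.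
case: (ltgtP y 0) => y0.
- rewrite (ltr0_sg y0) -[_ * _]opprK -mulrN sinN sgrN gtr0_sg//.
  apply: sin2_gt0; rewrite mulr_gt0 ?oppr_gt0//=.
  by rewrite mulrC ltr_pdivrMr// -ltr0_norm// (lt_le_trans ny)// ler_peMl// ler1n.
- rewrite (gtr0_sg y0) gtr0_sg//.
  apply: sin2_gt0; rewrite mulr_gt0//=.
  by rewrite mulrC ltr_pdivrMr// -(gtr0_norm y0) (lt_le_trans ny)// ler_peMl// ler1n.
- by rewrite y0 mulr0 sin0.
Unshelve. all: end_near. Qed.

End sign_iteration.

Section fourier_uniqueness.
Variables (R : realType) (mu nu : probability R R).
Implicit Types g h : R -> R.

(* The phase [b] gives sines as well as cosines, so that products of two such
   functions are again combinations of functions of the same form. *)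
Definition agree h :=
  forall w b, \int[mu]_x (h x * cos (w * x + b)) = \int[nu]_x (h x * cos (w * x + b)).

(* These functions form an algebra closed under bounded pointwise limits; a
   multiplier has the same integral for [mu] and [nu] as soon as the constant 1
   satisfies [agree]. *)
Definition multiplier g := bounded_measurable g /\
  forall h, bounded_measurable h -> agree h -> agree (h \* g).

Lemma bounded_measurable_cos (w b : R) :
  bounded_measurable (fun x : R => cos (w * x + b)).
Proof.
split; last by exists 1 => x; exact: cos_max.
apply: measurableT_comp.
  by apply: continuous_measurable_fun; exact: continuous_cos.
by apply: measurable_funD => //; exact: measurable_funM.
Qed.

Lemma bounded_measurable_cosM (w : R) : bounded_measurable (fun x : R => cos (w * x)).
Proof.
rewrite (_ : (fun _ => _) = fun x => cos (w * x + 0)).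
  exact: bounded_measurable_cos.
by apply/funext => x; rewrite addr0.
Qed.

Lemma bounded_measurable_sinM (w : R) : bounded_measurable (fun x : R => sin (w * x)).
Proof.
rewrite (_ : (fun _ => _) = fun x => cos (w * x - pi / 2)).
  exact: bounded_measurable_cos.
by apply/funext => x; rewrite cosBpihalf.
Qed.

Lemma multiplier_cst c : multiplier (cst c).
Proof.
split=> [|h bh ah w b /=]; first exact: bounded_measurable_cst.
under eq_Rintegral do rewrite mulrAC mulrC.
under [RHS]eq_Rintegral do rewrite mulrAC mulrC.
have bhc := bounded_measurableM bh (bounded_measurable_cos w b).
by rewrite !(bounded_measurable_RintegralZ _ c bhc) ah.
Qed.

Lemma multiplierD g1 g2 :
  multiplier g1 -> multiplier g2 -> multiplier (g1 \+ g2).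
Proof.
move=> [bg1 ag1] [bg2 ag2]; split=> [|h bh ah w b /=].
  exact: bounded_measurableD.
under eq_Rintegral do rewrite mulrDr mulrDl.
under [RHS]eq_Rintegral do rewrite mulrDr mulrDl.
have bc := bounded_measurable_cos w b.
have b1 := bounded_measurableM (bounded_measurableM bh bg1) bc.
have b2 := bounded_measurableM (bounded_measurableM bh bg2) bc.
rewrite !(bounded_measurable_RintegralD _ b1 b2).
by congr (_ + _); [exact: ag1|exact: ag2].
Qed.

(** This is where quantifying over all test functions pays: [h \* g1] is again one, and [g2] can be
    applied to it. *)
Lemma multiplierM g1 g2 :
  multiplier g1 -> multiplier g2 -> multiplier (g1 \* g2).
Proof.
move=> [bg1 ag1] [bg2 ag2]; split=> [|h bh ah w b].
  exact: bounded_measurableM.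
have /= := ag2 _ (bounded_measurableM bh bg1) (ag1 _ bh ah) w b.
by under eq_Rintegral do rewrite -(mulrA (h _));
  under [RHS]eq_Rintegral do rewrite -(mulrA (h _)).
Qed.

(** The product-to-sum formula gives cosines of frequencies [u + w] and [u - w] with shifted phases,
    to which [agree h] applies. *)
Lemma multiplier_cos (u c : R) : multiplier (fun x => cos (u * x + c)).
Proof.
split=> [|h bh ah w b /=]; first exact: bounded_measurable_cos.
have E x : h x * cos (u * x + c) * cos (w * x + b) =
    2^-1 * (h x * cos ((u + w) * x + (c + b)) + h x * cos ((u - w) * x + (c - b))).
  rewrite (_ : (u + w) * x + (c + b) = (u * x + c) + (w * x + b)); last by ring.
  rewrite (_ : (u - w) * x + (c - b) = (u * x + c) - (w * x + b)); last by ring.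
  by rewrite (cosD (u * x + c)) cosB; field.
have b1 := bounded_measurableM bh (bounded_measurable_cos (u + w) (c + b)).
have b2 := bounded_measurableM bh (bounded_measurable_cos (u - w) (c - b)).
under eq_Rintegral do rewrite E; under [RHS]eq_Rintegral do rewrite E.
rewrite !(bounded_measurable_RintegralZ _ _ (bounded_measurableD b1 b2)).
by rewrite !(bounded_measurable_RintegralD _ b1 b2) !ah.
Qed.

(** Bounded convergence holds under both measures, and the two sequences of integrals coincide,
    hence so do their limits. *)
Lemma multiplier_lim (M : R) (g_ : (R -> R)^nat) g :
  (forall n, multiplier (g_ n)) -> (forall n x, `|g_ n x| <= M) ->
  (forall x, g_ n x @[n --> \oo] --> g x) -> multiplier g.
Proof.
move=> mg gM cg; have bg n : bounded_measurable (g_ n) by have [] := mg n.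
split=> [|h bh ah w b]; first exact: bounded_measurable_lim bg gM cg.
have [mh [N hN]] := bh.
have bc := bounded_measurable_cos w b.
pose k n x := h x * g_ n x * cos (w * x + b).
have bk n : bounded_measurable (k n).
  exact: bounded_measurableM (bounded_measurableM bh (bg n)) bc.
have kM n x : `|k n x| <= N * M * 1.
  by rewrite /k !normrM ler_pM ?mulr_ge0 ?cos_max// ler_pM.
have ck x : k n x @[n --> \oo] --> h x * g x * cos (w * x + b).
  by apply: cvgMl; apply: cvgMr; exact: cg.
have L1 := bounded_convergence (mu := mu) bk kM ck.
apply: cvg_unique L1 _ => //.
rewrite (_ : (fun n => _) = fun n => \int[nu]_x k n x).
  exact: bounded_convergence bk kM ck.
by apply/funext => n; have [_ /(_ h bh ah w b)] := mg n.
Qed.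

Lemma multiplier_sin (u c : R) : multiplier (fun x => sin (u * (x - c))).
Proof.
rewrite (_ : (fun _ => _) = fun x => cos (u * x + (- (u * c) - pi / 2))).
  exact: multiplier_cos.
by apply/funext => x; rewrite addrA -mulrBr cosBpihalf.
Qed.

Lemma multiplier_sg_sin (u c : R) :
  multiplier (fun x => Num.sg (sin (u * (x - c)))).
Proof.
apply: (@multiplier_lim 1 (fun n x => iter n (@sign_step R) (sin (u * (x - c))))).
- elim=> [|n]; first exact: multiplier_sin.
  set s := (fun x => iter n _ _) => ih.
  (* One more iteration is a cubic polynomial in the previous iterate, hence stays in the
     algebra. *)
  rewrite [X in multiplier X](_ : _ =
      (cst (3 / 2) \* s) \+ (cst (- 2^-1) \* (s \* (s \* s)))).
    apply: multiplierD; apply: multiplierM; first exact: multiplier_cst.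
    - exact: ih.
    - exact: multiplier_cst.
    - by do 2 (apply: multiplierM; first exact: ih); exact: ih.
  by apply/funext => x; rewrite iterS -/(s x) /= /sign_step; field.
- by move=> n x; apply: norm_iter_sign_step; exact: sin_max.
- by move=> x; apply: cvg_iter_sign_step; exact: sin_max.
Qed.

Lemma multiplier_sg (c : R) : multiplier (fun x => Num.sg (x - c)).
Proof.
apply: (@multiplier_lim 1 (fun n x => Num.sg (sin (n.+1%:R^-1 * (x - c))))).
- by move=> n; exact: multiplier_sg_sin.
- by move=> n x; rewrite normr_sg lern1 leq_b1.
- by move=> x; exact: cvg_sg_sin.
Qed.

(** The polynomial [s * (s + 1) / 2] sends the signs -1, 0, 1 to 0, 0, 1; the value at 0 leaves the
    endpoint [c] out. *)
Lemma multiplier_indic (c : R) : multiplier (\1_`]c, +oo[ : R -> R).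
Proof.
rewrite (_ : \1__ = cst 2^-1 \* ((fun x => Num.sg (x - c)) \*
    ((fun x => Num.sg (x - c)) \+ cst 1))); last first.
  apply/funext => x /=; rewrite indicE mem_setE.
  rewrite in_itv/= andbT -subr_gt0; case: ltgtP => x0.
  - by rewrite gtr0_sg//=; field.
  - by rewrite ltr0_sg//=; field.
  - by rewrite -x0 sgr0 /=; field.
by repeat (apply: multiplierM || apply: multiplierD || apply: multiplier_cst
  || apply: multiplier_sg).
Qed.

Lemma fourier_unique :
  (forall w, \int[mu]_x cos (w * x) = \int[nu]_x cos (w * x)) ->
  (forall w, \int[mu]_x sin (w * x) = \int[nu]_x sin (w * x)) ->
  forall A, measurable A -> mu A = nu A.
Proof.
move=> Ecos Esin.
(* The hypotheses concern phase 0 only; the addition formula extends them to every phase. *)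
have agree1 : agree (cst 1).
  move=> w b.
  have bc := bounded_measurable_cosM w; have bs := bounded_measurable_sinM w.
  have E x : cst 1 x * cos (w * x + b) =
      cos b * cos (w * x) + - sin b * sin (w * x).
    by rewrite /= cosD; ring.
  under eq_Rintegral do rewrite E; under [RHS]eq_Rintegral do rewrite E.
  have bcb := bounded_measurableM (bounded_measurable_cst (cos b)) bc.
  have bsb := bounded_measurableM (bounded_measurable_cst (- sin b)) bs.
  rewrite !(bounded_measurable_RintegralD _ bcb bsb).
  rewrite !(bounded_measurable_RintegralZ _ _ bc).
  by rewrite !(bounded_measurable_RintegralZ _ _ bs) Ecos Esin.
have tails (c : R) : mu `]c, +oo[%classic = nu `]c, +oo[%classic.
  (* At frequency and phase 0 the cosine is 1, and the two integrals are the measures of the ray. *)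
  have [_ /(_ _ (bounded_measurable_cst 1) agree1 0 0)] := multiplier_indic c.
  under eq_Rintegral do rewrite /= mul0r add0r cos0 mulr1 mul1r.
  under [RHS]eq_Rintegral do rewrite /= mul0r add0r cos0 mulr1 mul1r.
  rewrite /Rintegral !integral_indic// !setIT => H.
  by rewrite -[LHS]fineK ?fin_num_measure// H fineK ?fin_num_measure.
(* Open right rays generate the Borel sets, are stable under intersection, and exhaust the line. *)
apply: (measure_unique (@RGenOInfty.G R) (fun n => `]- n%:R, +oo[%classic)).
- exact: RGenOInfty.measurableE.
- move=> _ _ [a ->] [b ->]; exists (Num.max a b); apply/seteqP; split=> x /=;
    rewrite !in_itv/= !andbT gt_max; first by case=> -> ->.
  by case/andP.
- by move=> n; exists (- n%:R).
- apply/seteqP; split => // x _; exists (Num.truncn `|x|).+1 => //=.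
  rewrite in_itv/= andbT ltrNl (le_lt_trans (ler_norm _))// normrN.
  exact: truncnS_gt.
- by move=> _ [a ->]; exact: tails.
- by move=> n; rewrite (le_lt_trans (probability_le1 _ _))// ltry.
Qed.

End fourier_uniqueness.

(** * Sums of independent random variables *)

(** The image of the Lebesgue measure under a translation gives half-open intervals their length,
    which characterizes the Lebesgue measure. *)
Lemma ge0_integral_lebesgue_translation (R : realType) (c : R)
    (g : R -> \bar R) : measurable_fun setT g -> (forall x, 0 <= g x)%E ->
  (\int[@lebesgue_measure R]_x g (x - c)%R = \int[@lebesgue_measure R]_x g x)%E.
Proof.
move=> mg g0.
have mB : @measurable_fun _ _ (measurableTypeR R) (measurableTypeR R) setT
    (fun x : R => x - c).
  exact: measurable_funB.
pose B : {mfun measurableTypeR R >-> measurableTypeR R} := HB.pack (fun x : R => x - c)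
  (isMeasurableFun.Build _ _ _ _ _ mB).
transitivity (\int[pushforward (@lebesgue_measure R) B]_x g x)%E.
  by rewrite [RHS](@ge0_integral_pushforward _ _ _ _ _ _ mB
    (@lebesgue_measure R) setT g measurableT mg).
apply: eq_measure_integral => A mA _; apply/esym.
apply: (@lebesgue_measure_unique R (pushforward (@lebesgue_measure R) B)) => //.
move=> _ [[a b] _ <-] /=; rewrite /pushforward.
rewrite (_ : _ @^-1` _ = `]a + c, b + c]%classic).
  rewrite !lebesgue_measure_itv/= !lte_fin ltrD2r -!EFinD.
  by rewrite opprD addrACA subrr addr0.
by apply/seteqP; split=> x /=; rewrite !in_itv/= ltrBrDr lerBlDr.
Qed.

Section independent_pair.
Context d (T : measurableType d) (R : realType) (P : probability T R).
Variables X Y : {RV P >-> R}.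
Hypothesis indep : independent_RV X Y.
Let PX := distribution P X.
Let PY := distribution P Y.

Let measurable_pair : measurable_fun [set: T] (fun s => (X s, Y s)).
Proof. exact: measurable_fun_pair. Qed.

Let pair_RV : {mfun T >-> (R * R)%type} := HB.pack (fun s => (X s, Y s))
  (isMeasurableFun.Build _ _ _ _ _ measurable_pair).

(** Independence is the equality on measurable rectangles, and these determine the product
    measure. *)
Lemma joint_distribution (A : set (R * R)) : measurable A ->
  (PX \x PY)%E A = P ((fun s => (X s, Y s)) @^-1` A).
Proof.
move=> mA.
rewrite (@product_measure_unique _ _ _ _ _ PX PY (distribution P pair_RV))//.
Qed.

Lemma independent_RintegralM (g h : R -> R) :
  bounded_measurable g -> bounded_measurable h ->
  \int[P]_s (g (X s) * h (Y s)) = \int[PX]_x g x * \int[PY]_y h y.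
Proof.
move=> bg bh; pose gh (z : R * R) := g z.1 * h z.2.
have bgh : bounded_measurable gh.
  have [[mg [M gM]] [mh [N hN]]] := (bg, bh).
  split; last by exists (M * N) => z; rewrite normrM ler_pM.
  by apply: measurable_funM; apply: measurableT_comp.
have bghP : bounded_measurable (gh \o pair_RV).
  have [mgh [M ghM]] := bgh; split; first exact: measurableT_comp.
  by exists M => s; exact: ghM.
rewrite /Rintegral -[LHS]/(fine (\int[P]_s ((EFin \o gh) \o pair_RV) s)%E).
rewrite -integral_distribution; last 2 first.
- by apply/measurable_EFinP; have [] := bgh.
- exact: bounded_measurable_integrable.
rewrite (@eq_measure_integral _ _ _ _ (PX \x PY)%E); last first.
  by move=> A mA _; rewrite /= joint_distribution.
(* Fubini's theorem splits the integral against the product law into an iterated one, from which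
   each factor is pulled out. *)
rewrite -integral12_prod_meas1; last exact: bounded_measurable_integrable.
rewrite -[RHS]/((\int[PX]_x g x) * (\int[PY]_y h y)) mulrC.
rewrite -(bounded_measurable_RintegralZ _ _ bg) /Rintegral; congr fine.
apply: eq_integral => x _; rewrite /fubini_F /gh/= mulrC.
rewrite -[X in _ = (_ * X)%:E]/(\int[PY]_y h y).
rewrite -(bounded_measurable_RintegralZ _ _ bh) fineK//.
apply: integrable_fin_num => //; apply: bounded_measurable_integrable.
exact: bounded_measurableM (bounded_measurable_cst (g x)) bh.
Qed.

End independent_pair.

(** * The density of the sum with an independent noise *)

Section spread_density.
Context d (T : measurableType d) (R : realType) (P : probability T R).
Variables (X K : {RV P >-> R}) (pK : R -> R).
Hypotheses (K_density : has_density K pK) (indep : independent_RV X K).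
Let PX := distribution P X.
Local Notation leb := (@lebesgue_measure R).

(** Unlike [spread_density], this keeps the value [+oo], so that Tonelli's theorem applies to it
    directly. *)
Definition espread_density (mu : probability R R) (t : R) : \bar R :=
  (\int[mu]_x (pK (t - x)%R)%:E)%E.

Let mpK : measurable_fun setT pK. Proof. by have [[]] := K_density. Qed.
Let pK0 x : 0 <= pK x. Proof. by have [[]] := K_density. Qed.

Let measurable_shifted :
  measurable_fun [set: measurableTypeR R * R] (fun z => pK (z.1 - z.2)).
Proof.
apply: measurableT_comp => //.
by apply: measurable_funB; [exact: measurable_fst|exact: measurable_snd].
Qed.

Lemma espread_density_ge0 mu t : (0 <= espread_density mu t)%E.
Proof. by apply: integral_ge0 => x _; rewrite lee_fin. Qed.

Lemma measurable_espread_density (mu : probability R R) :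
  measurable_fun setT (espread_density mu).
Proof.
apply: (@measurable_fun_fubini_tonelli_F _ _ (measurableTypeR R) R R mu
  (fun z => (pK (z.1 - z.2))%:E)).
- exact/measurable_EFinP.
- by move=> z; rewrite lee_fin.
Qed.

Lemma distribution_RV_add (A : set R) : measurable A ->
  distribution P (RV_add X K) A = (\int[leb]_(t in A) espread_density PX t)%E.
Proof.
move=> mA; pose B : set (R * R) := [set z | A (z.1 + z.2)].
have mB : measurable B.
  rewrite -[B]setTI; apply: (_ : measurable_fun setT (fun z : R * R => z.1 + z.2)) => //.
  by apply: measurable_funD; [exact: measurable_fst|exact: measurable_snd].
have -> : distribution P (RV_add X K) A = (PX \x distribution P K)%E B.
  by rewrite (joint_distribution indep).
have mAi : measurable_fun [set: measurableTypeR R] (\1_A : R -> R).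
  exact: measurable_indic.
pose G (z : measurableTypeR R * R) : \bar R := (pK (z.1 - z.2) * \1_A z.1)%:E.
have mG : measurable_fun setT G.
  apply/measurable_EFinP; apply: measurable_funM => //.
  by apply: (measurableT_comp mAi); exact: measurable_fst.
have G0 z : (0 <= G z)%E by rewrite lee_fin mulr_ge0.
transitivity (\int[PX]_x \int[leb]_t G (t, x))%E.
  apply: eq_integral => x _.
  have mBx : measurable (xsection B x) by exact: measurable_xsection.
  transitivity (\int[leb]_(k in xsection B x) (pK k)%:E)%E.
    by case: K_density => _; apply.
  (* The substitution [k = t - x] carries the section of [B] at [x] onto [A]. *)
  rewrite integral_mkcond -[LHS](ge0_integral_lebesgue_translation x); last 2 first.
  - apply: (measurable_restrictT (EFin \o pK) mBx).1.
    by apply: measurable_funTS; exact/measurable_EFinP.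
  - by move=> k; rewrite patchE; case: ifP; rewrite ?lee_fin.
  apply: eq_integral => t _; rewrite patchE /G /= indicE.
  have -> : (t - x \in xsection B x) = (t \in A).
    by rewrite mem_xsection; apply/idP/idP; rewrite !inE /B /= subrKC.
  by case: ifP; rewrite ?mulr1 ?mulr0.
(* Tonelli's theorem brings the integral over [t] outside; the indicator then restricts it to
   [A]. *)
rewrite -(fubini_tonelli (m1 := leb) (m2 := PX) G)//.
rewrite [RHS]integral_mkcond; apply: eq_integral => t _.
rewrite patchE /G /=; have [tA|tA] := boolP (t \in A).
  by apply: eq_integral => x _; rewrite indicE tA mulr1.
by rewrite integral0_eq// => x _; rewrite indicE (negbTE tA) mulr0.
Qed.

Lemma integral_espread_density : (\int[leb]_t espread_density PX t = 1)%E.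
Proof. by rewrite -distribution_RV_add// probability_setT. Qed.

(** The extended density has integral 1, so it is finite almost everywhere, and there [fine] loses
    nothing. *)
Lemma spread_density_ae :
  {ae leb, forall t, (spread_density pK PX t)%:E = espread_density PX t}.
Proof.
have : leb.-integrable setT (espread_density PX).
  apply/integrableP; split; first exact: measurable_espread_density.
  under eq_integral do rewrite gee0_abs ?espread_density_ge0//.
  by rewrite integral_espread_density ltry.
move=> /(integrable_ae measurableT); apply: filterS => t /(_ I).
by move=> /fineK <-.
Qed.

Lemma spread_density_ge0 mu t : 0 <= spread_density pK mu t.
Proof. by apply: Rintegral_ge0 => x _. Qed.

Lemma measurable_spread_density mu : measurable_fun setT (spread_density pK mu).
Proof. by apply: measurableT_comp => //; exact: measurable_espread_density. Qed.

Lemma has_density_RV_add : has_density (RV_add X K) (spread_density pK PX).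
Proof.
have E A : measurable A -> (\int[leb]_(t in A) (spread_density pK PX t)%:E =
    \int[leb]_(t in A) espread_density PX t)%E.
  move=> mA; apply: ae_eq_integral => //.
  - by apply/measurable_EFinP; apply: measurable_funTS; exact: measurable_spread_density.
  - by apply: measurable_funTS; exact: measurable_espread_density.
  - have [N [mN N0 subN]] := spread_density_ae.
    by exists N; split=> // t /= nE; apply: subN; apply: contra_not nE.
split; last by move=> A mA; rewrite distribution_RV_add// E.
split.
- exact: measurable_spread_density.
- exact: spread_density_ge0.
- by rewrite E// integral_espread_density.
Qed.

(** Positivity is claimed only almost everywhere because [spread_density] is 0 where the extended
    integral is infinite. *)
Lemma spread_density_gt0_ae : (forall x, 0 < pK x) ->
  {ae leb, forall t, 0 < spread_density pK PX t}.
Proof.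
move=> pK_gt0; move: spread_density_ae.
apply: (@filterS _ _ (ae_filter_ringOfSetsType leb)) => t Et.
rewrite -lte_fin Et lt_neqAle espread_density_ge0 andbT.
apply/negP => /eqP /esym E0.
have mt : measurable_fun setT (fun x : R => (pK ((t : R) - x))%:E).
  apply/measurable_EFinP; apply: measurableT_comp => //.
  exact: measurable_funB.
have : (\int[PX]_x `|(pK (t - x))%:E| = 0)%E.
  by rewrite -[RHS]E0; apply: eq_integral => x _; rewrite gee0_abs ?lee_fin.
move=> /(ae_eq_integral_abs PX measurableT mt) [N [mN N0 subN]].
(* The integrand vanishes off the null set [N], yet it is positive everywhere; so [N] is the whole
   line, whose probability is 1. *)
have NT : N = setT.
  apply/seteqP; split => // x _; apply: subN => /= /(_ I) -[].
  by apply/eqP; rewrite gt_eqF.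
have : PX N = 1%E by rewrite NT; exact: (probability_setT (distribution P X)).
by move=> /eqP; rewrite [X in X == _]N0 eq_sym onee_eq0.
Qed.

End spread_density.

(** * Characteristic functions and deconvolution *)

Lemma countable_setC_approx (R : realType) (Z : set R) (w : R) : countable Z ->
  exists2 w_ : R^nat, forall n, ~ Z (w_ n) & w_ n @[n --> \oo] --> w.
Proof.
move=> cZ.
have H (n : nat) : exists v, ~ Z v /\ w < v < w + n.+1%:R^-1.
  apply: contrapT => /forallNP nZ.
  have sub : `]w, w + n.+1%:R^-1[%classic `<=` Z.
    move=> v /=; rewrite in_itv/= => wv; apply: contrapT => Zv.
    exact: (nZ v).
  (* A countable set is Lebesgue-null and so cannot contain an interval of positive length. *)
  have := countable_lebesgue_measure0 (sub_countable (subset_card_le sub) cZ).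
  have n0 : 0 < n.+1%:R^-1 :> R by rewrite invr_gt0.
  rewrite lebesgue_measure_itv/= lte_fin ltrDl n0 -EFinD => -[].
  by move=> /eqP; rewrite addrAC subrr add0r gt_eqF.
have [w_ Hw] := choice H; exists w_ => [n|]; first by have [] := Hw n.
apply: (@squeeze_cvgr _ _ _ _ (cst w) (fun n => w + n.+1%:R^-1)).
- by apply: nearW => n; have [_ /andP[/ltW -> /ltW ->]] := Hw n.
- exact: cvg_cst.
- by rewrite -[X in _ --> X]addr0; apply: cvgD; [exact: cvg_cst|exact: cvg_harmonic].
Qed.

Section characteristic_function.
Variable R : realType.
Implicit Types (mu nu : probability R R) (w : R).

(** Sequential continuity of the real part of the characteristic function; the sine version handles
    the imaginary part. *)
Lemma cvg_Rintegral_cos mu (w_ : R^nat) w : w_ n @[n --> \oo] --> w ->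
  \int[mu]_x cos (w_ n * x) @[n --> \oo] --> \int[mu]_x cos (w * x).
Proof.
move=> cw; apply: (@bounded_convergence _ _ _ _ 1 (fun n x => cos (w_ n * x))).
- by move=> n; exact: bounded_measurable_cosM.
- by move=> n x; exact: cos_max.
- move=> x; apply: continuous_cvg; first exact: continuous_cos.
  by apply: cvgM => //; exact: cvg_cst.
Qed.

Lemma cvg_Rintegral_sin mu (w_ : R^nat) w : w_ n @[n --> \oo] --> w ->
  \int[mu]_x sin (w_ n * x) @[n --> \oo] --> \int[mu]_x sin (w * x).
Proof.
move=> cw; apply: (@bounded_convergence _ _ _ _ 1 (fun n x => sin (w_ n * x))).
- by move=> n; exact: bounded_measurable_sinM.
- by move=> n x; exact: sin_max.
- move=> x; apply: continuous_cvg; first exact: continuous_sin.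
  by apply: cvgM => //; exact: cvg_cst.
Qed.

Lemma fourier_unique_countable mu nu (Z : set R) : countable Z ->
  (forall w, ~ Z w -> \int[mu]_x cos (w * x) = \int[nu]_x cos (w * x)) ->
  (forall w, ~ Z w -> \int[mu]_x sin (w * x) = \int[nu]_x sin (w * x)) ->
  forall A, measurable A -> mu A = nu A.
Proof.
move=> cZ Ecos Esin; apply: (@fourier_unique R mu nu) => w;
  have [w_ Zw cw] := countable_setC_approx w cZ.
- apply: cvg_unique (cvg_Rintegral_cos (mu := mu) cw) _ => //.
  rewrite (_ : (fun n => _) = fun n => \int[nu]_x cos (w_ n * x)).
    exact: cvg_Rintegral_cos.
  by apply/funext => n; exact: Ecos.
- apply: cvg_unique (cvg_Rintegral_sin (mu := mu) cw) _ => //.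
  rewrite (_ : (fun n => _) = fun n => \int[nu]_x sin (w_ n * x)).
    exact: cvg_Rintegral_sin.
  by apply/funext => n; exact: Esin.
Qed.

Context d (T : measurableType d) (P : probability T R).
Implicit Types X Y K : {RV P >-> R}.

Lemma bounded_measurable_comp X (g : R -> R) :
  bounded_measurable g -> bounded_measurable (g \o X).
Proof.
move=> [mg [M gM]]; split; first exact: measurableT_comp.
by exists M => s; exact: gM.
Qed.

Lemma Rintegral_distribution X (g : R -> R) : bounded_measurable g ->
  \int[distribution P X]_x g x = \int[P]_s g (X s).
Proof.
move=> bg; congr fine; apply: integral_distribution.
- by apply/measurable_EFinP; have [] := bg.
- exact: bounded_measurable_integrable (bounded_measurable_comp X bg).
Qed.

Lemma char_funE K w : char_fun K w =
  Complex (\int[distribution P K]_x cos (w * x))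
          (\int[distribution P K]_x sin (w * x)).
Proof.
rewrite (Rintegral_distribution K (bounded_measurable_cosM w)).
rewrite (Rintegral_distribution K (bounded_measurable_sinM w)).
by rewrite /char_fun /cexpectation !expectation.unlock.
Qed.

(** The real part of [phi_(X + K) = phi_X * phi_K]; the next lemma is the imaginary part. *)
Lemma Rintegral_cos_add X K w : independent_RV X K ->
  \int[distribution P (RV_add X K)]_x cos (w * x) =
  \int[distribution P X]_x cos (w * x) * \int[distribution P K]_x cos (w * x) -
  \int[distribution P X]_x sin (w * x) * \int[distribution P K]_x sin (w * x).
Proof.
move=> indep.
have bc := bounded_measurable_cosM w; have bs := bounded_measurable_sinM w.
rewrite (Rintegral_distribution _ bc).
rewrite -(independent_RintegralM indep bc bc) -(independent_RintegralM indep bs bs).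
rewrite -RintegralB//; last 2 first.
- apply: bounded_measurable_integrable.
  exact: bounded_measurableM (bounded_measurable_comp X bc)
    (bounded_measurable_comp K bc).
- apply: bounded_measurable_integrable.
  exact: bounded_measurableM (bounded_measurable_comp X bs)
    (bounded_measurable_comp K bs).
by apply: eq_Rintegral => s _; rewrite mulrDr cosD.
Qed.

Lemma Rintegral_sin_add X K w : independent_RV X K ->
  \int[distribution P (RV_add X K)]_x sin (w * x) =
  \int[distribution P X]_x sin (w * x) * \int[distribution P K]_x cos (w * x) +
  \int[distribution P X]_x cos (w * x) * \int[distribution P K]_x sin (w * x).
Proof.
move=> indep.
have bc := bounded_measurable_cosM w; have bs := bounded_measurable_sinM w.
rewrite (Rintegral_distribution _ bs).
rewrite -(independent_RintegralM indep bs bc) -(independent_RintegralM indep bc bs).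
have bcX := bounded_measurable_comp X bc.
have bcK := bounded_measurable_comp K bc.
have bsX := bounded_measurable_comp X bs.
have bsK := bounded_measurable_comp K bs.
rewrite -(bounded_measurable_RintegralD P (bounded_measurableM bsX bcK)
  (bounded_measurableM bcX bsK)).
by apply: eq_Rintegral => s _; rewrite mulrDr sinD.
Qed.

Lemma deconvolution X Y K : independent_RV X K -> independent_RV Y K ->
  countable [set w : R | char_fun K w = 0] ->
  (forall A, measurable A ->
    distribution P (RV_add X K) A = distribution P (RV_add Y K) A) ->
  forall A, measurable A -> distribution P X A = distribution P Y A.
Proof.
move=> indX indY cZ lawE.
have EXY g : \int[distribution P (RV_add X K)]_x g x =
    \int[distribution P (RV_add Y K)]_x g x.
  by congr fine; apply: eq_measure_integral => A mA _; exact: lawE.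
have E w : ~ [set w : R | char_fun K w = 0] w ->
    \int[distribution P X]_x cos (w * x) = \int[distribution P Y]_x cos (w * x) /\
    \int[distribution P X]_x sin (w * x) = \int[distribution P Y]_x sin (w * x).
  rewrite /= char_funE.
  have := EXY (fun x => cos (w * x)); have := EXY (fun x => sin (w * x)).
  rewrite !Rintegral_cos_add// !Rintegral_sin_add//.
  set a := \int[distribution P X]_x cos _; set b := \int[distribution P X]_x sin _.
  set a' := \int[distribution P Y]_x cos _; set b' := \int[distribution P Y]_x sin _.
  set c := \int[distribution P K]_x cos _; set s := \int[distribution P K]_x sin _.
  move=> /eqP; rewrite -subr_eq0 => /eqP E1 /eqP; rewrite -subr_eq0 => /eqP E2 cs0.
  (* This is the squared modulus of the characteristic function of [K] at [w]. *)
  have cs : c ^+ 2 + s ^+ 2 != 0.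
    apply/negP; rewrite paddr_eq0 ?sqr_ge0// !sqrf_eq0 => /andP[/eqP c0 /eqP s0].
    by apply: cs0; rewrite c0 s0.
  (* Both combinations below come from multiplying [(phi_X - phi_Y) * phi_K = 0] by the conjugate of
     [phi_K] and taking real and imaginary parts. *)
  split; apply: (mulIf cs); apply/eqP; rewrite -subr_eq0; apply/eqP.
  - transitivity (c * (a * c - b * s - (a' * c - b' * s)) +
                  s * (b * c + a * s - (b' * c + a' * s))); first by ring.
    by rewrite E1 E2 !mulr0 addr0.
  - transitivity (c * (b * c + a * s - (b' * c + a' * s)) -
                  s * (a * c - b * s - (a' * c - b' * s))); first by ring.
    by rewrite E1 E2 !mulr0 subr0.
by apply: (fourier_unique_countable cZ) => w /E[].
Qed.

End characteristic_function.

(** * Nonnegativity of the f-divergence *)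

Section divergence.
Variables (R : realType) (f : R -> R).
Hypothesis f_convex : convex_function (`]0, +oo[%classic : set R) f.
Local Notation leb := (@lebesgue_measure R).

Lemma convex_segment (x y t : R) : 0 < x -> 0 < y -> 0 <= t <= 1 ->
  f (t * x + (1 - t) * y) <= t * f x + (1 - t) * f y.
Proof.
move=> x0 y0 /andP[t0 t1].
have := f_convex (Itv01 t0 t1) (x := x) (y := y).
by rewrite !inE/= !in_itv/= !andbT => /(_ x0 y0).
Qed.

(** Convexity at three points with the denominators cleared, a form suited to linear arithmetic. *)
Lemma convex_slopes (x y z : R) : 0 < x -> x < y -> y < z ->
  (z - x) * f y <= (z - y) * f x + (y - x) * f z.
Proof.
move=> x0 xy yz; have zx : 0 < z - x by lra.
pose t := (z - y) / (z - x).
have t01 : 0 <= t <= 1.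
  by rewrite /t divr_ge0/= ?ler_pdivrMr ?mul1r//; lra.
have yE : t * x + (1 - t) * z = y by rewrite /t; field; lra.
have := @convex_segment x z t x0 ltac:(lra) t01.
rewrite yE -(ler_pM2l zx) => /le_trans; apply; rewrite le_eqVlt; apply/orP; left.
by apply/eqP; rewrite /t; field; lra.
Qed.

(** The slope is the left derivative at 1, obtained as the supremum of the slopes of the chords from
    the left; every chord slope on the right bounds these. *)
Lemma convex_tangent : f 1 = 0 ->
  exists c, forall u, 0 < u -> c * (u - 1) <= f u.
Proof.
move=> f1.
pose S := [set f u / (u - 1) | u in [set u | 0 < u < 1]].
have H u v : 0 < u < 1 -> 1 < v -> f u / (u - 1) <= f v / (v - 1).
  move=> /andP[u0 u1] v1; have := convex_slopes u0 u1 v1.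
  rewrite f1 mulr0 => H0.
  rewrite ler_pdivlMr ?subr_gt0// mulrAC ler_ndivrMr ?subr_lt0//; nra.
have ubS : has_sup S.
  split; first by exists (f 2^-1 / (2^-1 - 1)), 2^-1 => //=; apply/andP; split; lra.
  by exists (f 2 / (2 - 1)) => _ [u u01 <-]; apply: H => //; lra.
exists (sup S) => u u0; case: (ltgtP u 1) => u1.
- rewrite -ler_ndivrMr ?subr_lt0//; apply: sup_upper_bound => //.
  by exists u => //=; rewrite u0.
- rewrite -ler_pdivlMr ?subr_gt0//; apply: ge_sup; first by case: ubS.
  by move=> _ [v v01 <-]; exact: H.
- by rewrite u1 f1 subrr mulr0.
Qed.

(** By convexity the strict sublevel sets of [f] are intervals. *)
Lemma measurable_convex : measurable_fun (`]0, +oo[%classic : set R) f.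
Proof.
move=> mD; apply: (measurability _ (RGenInftyO.measurableE R)) => //.
move=> _ [_ [r ->] <-]; apply: is_interval_measurable => x z /=.
rewrite !in_itv/= !andbT => -[x0 fx] [z0 fz] y /andP[xy yz].
rewrite !in_itv/= andbT; split; first exact: lt_le_trans xy.
move: xy yz; rewrite !le_eqVlt => /predU1P[<-//|xy] /predU1P[->//|yz].
have zx : 0 < z - x by lra.
have h1 : 0 < (z - y) * (r - f x) by rewrite mulr_gt0// subr_gt0.
have h2 : 0 < (y - x) * (r - f z) by rewrite mulr_gt0// subr_gt0.
rewrite -(ltr_pM2l zx); have := convex_slopes x0 xy yz; lra.
Qed.

Lemma measurable_divergence_integrand (p q : R -> R) :
  measurable_fun setT p -> measurable_fun setT q ->
  (forall x, 0 <= p x) -> (forall x, 0 <= q x) ->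
  measurable_fun setT (fun x => f (p x / q x) * q x).
Proof.
move=> mp mq p0 q0; apply: measurable_funM => //.
(* Nothing is known of [f] outside the positive reals; the quotient is nonnegative, so only the
   value at 0 must be kept. *)
pose f0 u := if 0 < u then f u else f 0.
have mf0 : measurable_fun setT f0.
  apply: measurable_fun_if => //.
  - by apply: measurable_fun_ltr.
  - rewrite setTI (_ : _ @^-1` _ = `]0, +oo[%classic); first exact: measurable_convex.
    by apply/seteqP; split=> u /=; rewrite in_itv/= andbT.
(* The inverse becomes a real power, which is measurable; the two agree on nonnegative reals, with
   value 0 at 0. *)
rewrite (_ : (fun _ => _) = f0 \o (fun x => p x * q x `^ (-1))); last first.
  apply/funext => x; rewrite /f0 /= powR_inv1//; case: ltP => // pq0.
  by congr f; apply/eqP; rewrite eq_le pq0/= divr_ge0.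
apply: measurableT_comp => //; apply: measurable_funM => //.
exact: (@measurableT_comp _ _ _ _ _ _ (@powR R ^~ (-1))).
Qed.

Lemma f_divergence_ae_eq (p q p' q' : R -> R) :
  measurable_fun setT p -> measurable_fun setT q ->
  measurable_fun setT p' -> measurable_fun setT q' ->
  (forall x, 0 <= p x) -> (forall x, 0 <= q x) ->
  (forall x, 0 <= p' x) -> (forall x, 0 <= q' x) ->
  {ae leb, forall x, p x = p' x} -> {ae leb, forall x, q x = q' x} ->
  f_divergence f p q = f_divergence f p' q'.
Proof.
move=> mp mq mp' mq' p0 q0 p'0 q'0 pp' qq'.
apply: ae_eq_integral => //.
- by apply/measurable_EFinP; apply: measurable_divergence_integrand.
- by apply/measurable_EFinP; apply: measurable_divergence_integrand.
- move: pp' qq'; apply: (@filterS2 _ _ (ae_filter_ringOfSetsType leb)).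
  by move=> x /= -> -> _.
Qed.

Lemma f_divergence_ge0 (p q : R -> R) : f 1 = 0 ->
  prob_density p -> (forall x, 0 < p x) ->
  prob_density q -> (forall x, 0 < q x) -> (0 <= f_divergence f p q)%E.
Proof.
move=> f1 [mp p0 p1] pp [mq q0 q1] qp.
have [c fc] := convex_tangent f1.
pose g x := f (p x / q x) * q x; pose h x := c * (p x - q x).
have hg x : h x <= g x.
  rewrite /g /h (_ : c * _ = c * (p x / q x - 1) * q x).
    by rewrite ler_pM2r// fc// divr_gt0.
  by field; rewrite gt_eqF.
have ip : leb.-integrable setT (EFin \o p).
  apply/integrableP; split; first exact/measurable_EFinP.
  by under eq_integral do rewrite /= ger0_norm//; rewrite p1 ltry.
have iq : leb.-integrable setT (EFin \o q).
  apply/integrableP; split; first exact/measurable_EFinP.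
  by under eq_integral do rewrite /= ger0_norm//; rewrite q1 ltry.
have mg : measurable_fun setT (EFin \o g).
  by apply/measurable_EFinP; apply: measurable_divergence_integrand => // x; exact: ltW.
have mh : measurable_fun setT (EFin \o h).
  by apply/measurable_EFinP; apply: measurable_funM => //; exact: measurable_funB.
have h0 : (\int[leb]_x (h x)%:E = 0)%E.
  rewrite [LHS](_ : _ = \int[leb]_x (c%:E * ((EFin \o p) \- (EFin \o q)) x))%E//.
  rewrite integralZl//; last exact: integrableB.
  by rewrite integralB// p1 q1 subee// mule0.
(* The integrand [g] may fail to be integrable, so positive and negative parts are compared
   separately. *)
rewrite -h0 /f_divergence -/g integralE [leRHS]integralE; apply: leeB.
- apply: ge0_le_integral => //; [exact: measurable_funepos|exact: measurable_funepos|].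
  by move=> x _; apply: (@funepos_le _ _ setT) => [y _|]; rewrite ?inE// lee_fin.
- apply: ge0_le_integral => //; [exact: measurable_funeneg|exact: measurable_funeneg|].
  by move=> x _; apply: (@funeneg_le _ _ setT) => [y _|]; rewrite ?inE// lee_fin.
Qed.

End divergence.

(** * Positive versions of densities, and the spread divergence *)

Lemma prob_density_positive (R : realType) (p : R -> R) :
  prob_density p -> {ae @lebesgue_measure R, forall x, 0 < p x} ->
  exists p' : R -> R, [/\ prob_density p', forall x, 0 < p' x &
    {ae @lebesgue_measure R, forall x, p x = p' x}].
Proof.
move=> [mp p0 p1] pos; pose p' x := if 0 < p x then p x else 1.
have mp' : measurable_fun setT p'.
  by apply: measurable_fun_ifT => //; exact: measurable_fun_ltr.
have pp' : {ae @lebesgue_measure R, forall x, p x = p' x}.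
  move: pos; apply: (@filterS _ _ (ae_filter_ringOfSetsType (@lebesgue_measure R))).
  by move=> x; rewrite /p' => ->.
have p'0 x : 0 < p' x by rewrite /p'; case: ifP.
exists p'; split => //; split => //; first by move=> x; exact: ltW.
rewrite -p1; apply: ae_eq_integral => //.
- exact/measurable_EFinP.
- exact/measurable_EFinP.
- move: pp'; apply: (@filterS _ _ (ae_filter_ringOfSetsType (@lebesgue_measure R))).
  by move=> x /= -> _.
Qed.

Lemma independent_RV_sym d (T : measurableType d) (R : realType)
    (P : probability T R) (X Y : {RV P >-> R}) :
  independent_RV X Y -> independent_RV Y X.
Proof. by move=> indep A B mA mB; rewrite setIC muleC indep. Qed.

Theorem theorem1 (R : realType) (f : R -> R)
  (f_convex : convex_function (`]0, +oo[%classic : set R) f)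
  (f1 : f 1 = 0)
  (f_div : forall p q : R -> R,
    prob_density p -> (forall x, 0 < p x) ->
    prob_density q -> (forall x, 0 < q x) ->
    (f_divergence f p q = 0%E <-> {ae @lebesgue_measure R, forall x, p x = q x}))
  (d : measure_display) (T : measurableType d) (P : probability T R)
  (X Y K : {RV P >-> R}) (pK : R -> R)
  (K_density : has_density K pK)
  (pK_gt0 : forall x, 0 < pK x)
  (indepX : independent_RV K X)
  (indepY : independent_RV K Y)
  (phiK : (forall w : R, char_fun K w <> 0) \/
          countable [set w : R | char_fun K w = 0]) :
  [/\ has_density (RV_add X K) (spread_density pK (distribution P X)),
      has_density (RV_add Y K) (spread_density pK (distribution P Y)),
      (0 <= spread_divergence f pK (distribution P X) (distribution P Y))%E &
      (spread_divergence f pK (distribution P X) (distribution P Y) = 0%E <->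
       forall A : set R, measurable A -> distribution P X A = distribution P Y A)].
Proof.
have indX := independent_RV_sym indepX; have indY := independent_RV_sym indepY.
have dX := has_density_RV_add K_density indX.
have dY := has_density_RV_add K_density indY.
have cZ : countable [set w : R | char_fun K w = 0].
  case: phiK => // phi0; rewrite (_ : mkset _ = set0) ?countable0//.
  by apply/seteqP; split => // w; exact: phi0.
(* The hypothesis on [f] requires densities positive everywhere; the spread densities are replaced
   by such versions. *)
have [p [dp p0 pE]] := prob_density_positive dX.1
  (spread_density_gt0_ae K_density indX pK_gt0).
have [q [dq q0 qE]] := prob_density_positive dY.1
  (spread_density_gt0_ae K_density indY pK_gt0).
have DE : spread_divergence f pK (distribution P X) (distribution P Y) =
    f_divergence f p q.
  have [[mpX pX0 _] _] := dX; have [[mpY pY0 _] _] := dY.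
  have [mp _ _] := dp; have [mq _ _] := dq.
  by apply: f_divergence_ae_eq => // x; exact: ltW.
split=> //; first by rewrite DE f_divergence_ge0.
split=> [|lawE].
- rewrite DE => /(f_div _ _ dp p0 dq q0).1 pq.
  (* It remains to compare the laws of the two sums, whose densities agree almost everywhere. *)
  apply: (deconvolution indX indY cZ) => A mA.
  have [[mpX _ _] ->//] := dX; have [[mpY _ _] ->//] := dY.
  apply: ae_eq_integral => //.
  + by apply/measurable_EFinP; exact: measurable_funTS.
  + by apply/measurable_EFinP; exact: measurable_funTS.
  + move: pE qE pq.
    apply: (@filterS3 _ _ (ae_filter_ringOfSetsType (@lebesgue_measure R))).
    by move=> t /= -> -> -> _.
- have SE : spread_density pK (distribution P X) =
      spread_density pK (distribution P Y).
    apply/funext => t; congr fine; apply: eq_measure_integral => A mA _.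
    exact: lawE.
  rewrite /spread_divergence SE.
  rewrite /f_divergence integral0_eq// => t _.
  (* Where the density is 0, which includes its default value, the factor outside [f] annihilates
     the integrand; elsewhere the ratio is 1. *)
  set s := spread_density _ _ _; have [->|s0] := eqVneq s 0.
    by rewrite mulr0.
  by rewrite divff// f1 mul0r.
Qed.
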